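(* Let $(p_n)_{n\ge 1}$ be a sequence in $[0,1]$ with $$\lim_{n \to \infty} n p_n (1-p_n) = \infty .$$ Then for every sequence of Boolean functions $f_n \colon \{-1,1\}^n \to \{-1,1\}$, $n \ge 1$, there exists a sequence of Boolean functions $g_n \colon \{-1,1\}^n \to \{-1,1\}$, $n\ge 1$, such that $(g_n)$ is volatile with respect to $(p_n)$ and $(f_n)$ and $(g_n)$ are $o(1)$-close with respect to $(p_n)$.
   Context: For each $n$, let $(X_t^{(n)})_{t\ge 0}$ be the continuous-time Markov chain on $\{-1,1\}^n$ in which each coordinate independently carries a rate-one exponential clock; whenever the clock of a coordinate rings, the value of that coordinate is resampled independently, being set to $1$ with probability $p_n$ and to $-1$ with probability $1-p_n$. The chain is started from its stationary distribution, i.e. the coordinates of $X_0^{(n)}$ are i.i.d., equal to $1$ with probability $p_n$ and to $-1$ with probability $1-p_n$. Write $P_{p_n}$ for the law of this process, and $X_t = X_t^{(n)}$. Volatile: for $f_n\colon\{-1,1\}^n\to\{-1,1\}$ let $\tau_{\partial f_n} = \inf\{t \ge 0 : f_n(X_t^{(n)}) \ne f_n(X_0^{(n)})\}$ (with $\inf\emptyset=\infty$), the hitting time of the set $\{x : f_n(x)\neq f_n(X_0)\}$. The sequence $(f_n)$ is volatile with respect to $(p_n)$ if for all $\delta>0$, $\lim_{n\to\infty} P_{p_n}[\tau_{\partial f_n} > \delta] = 0$. $o(1)$-close: sequences $(f_n)$ and $(g_n)$ of functions $f_n,g_n\colon\{-1,1\}^n\to\{-1,1\}$ are $o(1)$-close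 with respect to $(p_n)$ if $\lim_{n\to\infty} P_{p_n}[f_n(X_0^{(n)}) \ne g_n(X_0^{(n)})] = 0$. *)

(* Defs.v *)
From HB Require Import structures.
From mathcomp Require Import all_boot all_order all_algebra.
From mathcomp Require Import finmap.
From mathcomp Require Import all_classical all_reals all_analysis.
Set Implicit Arguments.
Unset Strict Implicit.
Unset Printing Implicit Defensive.
Import Order.TTheory GRing.Theory Num.Theory.
Import numFieldNormedType.Exports.
Local Open Scope classical_set_scope.
Local Open Scope ring_scope.

(* {-1,1}^n, with [true] standing for 1 and [false] for -1. *)
Notation cube n := {ffun 'I_n -> bool}.

(* The same encoding is used for the values: f n : {-1,1}^n -> {-1,1}. *)
Notation boolfun_seq := (forall n : nat, cube n -> bool).

Definition mutually_independent (d : measure_display) (T : measurableType d)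
    (R : realType) (P : probability T R) (I : choiceType)
    (G : I -> set (set T)) : Prop :=
  forall (J : {fset I}) (A : I -> set T),
    (forall j, j \in J -> G j (A j)) ->
    P (\bigcap_(j in [set` J]) A j) = (\prod_(j <- J) P (A j))%E.

(* [arrival gap k] is the time of the k-th ring (k >= 1) of a clock whose
   successive waiting times are [gap 0], [gap 1], ... *)
Definition arrival (R : realType) (gap : nat -> R) (k : nat) : R :=
  \sum_(j < k) gap j.

(* Number of rings in the time interval [0, t]; the set is finite for the clocks
   considered below, by [gap_gt0] and [arrival_unbounded]. *)
Definition ring_count (R : realType) (gap : nat -> R) (t : R) : nat :=
  #|` fset_set [set k : nat | arrival gap k.+1 <= t]|.

(* A realization, on some probability space, of the resampling dynamics on
   {-1,1}^n with parameter p.  [gap i k] is the waiting time between the k-th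
   and the (k+1)-st ring of the clock of coordinate i (the time to the first ring
   if k = 0); [spin i 0] is the initial
   value of coordinate i and [spin i k], k >= 1, the value it is given at the
   k-th ring.
   [gap_gt0] and [arrival_unbounded] hold almost surely for i.i.d. exponential
   waiting times; asking for them at every sample point (i.e. choosing the
   usual regular version) makes all paths piecewise constant and
   right-continuous, so that the events about exit times are measurable. *)
Record dynamics (R : realType) (n : nat) (p : R) := Dynamics {
  disp : measure_display;
  sample : measurableType disp;
  prob : probability sample R;
  gap : 'I_n -> nat -> {RV prob >-> R};
  spin : 'I_n -> nat -> {RV prob >-> bool};
  gap_exponential : forall i k (B : set R), measurable B ->
    distribution prob (gap i k) B = exponential_prob 1 B;
  spin_bernoulli : forall i k (B : set bool),
    distribution prob (spin i k) B = bernoulli_prob p B;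
  gap_spin_independent : mutually_independent prob
    (fun j : ('I_n * nat) + ('I_n * nat) =>
       match j with
       | inl (i, k) => preimage_set_system setT (gap i k) measurable
       | inr (i, k) => preimage_set_system setT (spin i k) measurable
       end);
  gap_gt0 : forall i k w, 0 < gap i k w;
  arrival_unbounded : forall i w (t : R),
    exists k, t < arrival (fun j => gap i j w) k
}.

Definition state (R : realType) (n : nat) (p : R) (X : dynamics n p) (t : R)
    (w : sample X) : cube n :=
  [ffun i => spin X i (ring_count (fun j => gap X i j w) t) w].

(* [ereal_inf set0] is [+oo]. *)
Definition exit_time (R : realType) (n : nat) (p : R) (X : dynamics n p)
    (f : cube n -> bool) (w : sample X) : \bar R :=
  ereal_inf [set t%:E | t in
    [set t : R | 0 <= t /\ f (state t w) <> f (state 0 w)]].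

Definition volatile (R : realType) (p : nat -> R)
    (X : forall n, dynamics n (p n)) (f : boolfun_seq) : Prop :=
  forall delta : R, 0 < delta ->
    (fun n => prob (X n) [set w | (delta%:E < exit_time (f n) w)%E])
      @ \oo --> 0%E.

Definition o1_close (R : realType) (p : nat -> R)
    (X : forall n, dynamics n (p n)) (f g : boolfun_seq) : Prop :=
  (fun n => prob (X n) [set w | f n (state 0 w) <> g n (state 0 w)])
    @ \oo --> 0%E.

(* Main.v *)
(* Write S(x) for the number of ones of x, and T for S(X_t) - S(X_0).  Choose an
   integer m and residues r <> r' such that the events S(X_0) = r and S(X_0) = r'
   modulo m have probability at most about 1/m, and let g be true on the first,
   false on the second, and equal to f elsewhere; then g is close to f.  Almost
   surely no two clocks ring at the same time, so S moves by steps of at most 1: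
   as soon as |T| >= m, both residues have been visited before t, and g has
   changed value.  The increment T is a sum of n i.i.d. symmetric steps in
   {-1, 0, 1}, each equal to 1 with probability q = p (1 - p) (1 - exp(-t)), so
   E cos(a T) = (1 - 2 q (1 - cos a))^n, which tends to 0 as n p (1 - p) does to
   infinity; averaging over several frequencies a shows that |T| <= m is then
   unlikely.  Finally m is let tend to infinity slowly with n, along with t = 1/m. *)
Require Import Defs.
From HB Require Import structures.
From mathcomp Require Import all_boot all_order all_algebra.
From mathcomp Require Import finmap.
From mathcomp Require Import all_classical all_reals all_analysis.
From mathcomp Require Import measurable_realfun.
From mathcomp Require Import ring lra zify.
From mathcomp Require Import complex.
Set Implicit Arguments.
Unset Strict Implicit.
Unset Printing Implicit Defensive.
Import Order.TTheory GRing.Theory Num.Theory.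
Import numFieldNormedType.Exports.
Local Open Scope classical_set_scope.
Local Open Scope ring_scope.

(** * Clocks and skip-free paths *)

Section Clock.
Variables (R : realType) (gap : nat -> R).
Hypothesis gap_gt0 : forall k, 0 < gap k.
Hypothesis unbounded : forall t : R, exists k, t < arrival gap k.

Lemma arrival0 : arrival gap 0 = 0.
Proof. by rewrite /arrival big_ord0. Qed.

Lemma arrivalS k : arrival gap k.+1 = arrival gap k + gap k.
Proof. by rewrite /arrival big_ord_recr. Qed.

Lemma arrival_homo : {homo arrival gap : j k / (j < k)%N >-> j < k}.
Proof.
by apply: homo_ltn => [y x z|k]; [exact: lt_trans | rewrite arrivalS ltrDl].
Qed.

Lemma arrival_mono : {mono arrival gap : j k / (j <= k)%N >-> j <= k}.
Proof.
move=> j k; case: (leqP j k) => [|kj]; last first.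
  by apply/negbTE; rewrite -ltNge arrival_homo.
by rewrite leq_eqVlt => /predU1P[->|/arrival_homo/ltW]; rewrite ?lexx.
Qed.

Lemma arrival_le t k : 0 <= t -> (arrival gap k <= t) = (k <= ring_count gap t)%N.
Proof.
move=> t0; have [[|c] tc cmin] := ex_minnP (unbounded t).
  by move: tc; rewrite arrival0 ltNge t0.
have ct : arrival gap c <= t.
  by rewrite leNgt; apply/negP => /cmin; rewrite ltnn.
have leE j : (arrival gap j <= t) = (j <= c)%N.
  case: (leqP j c) => cj; first by apply: le_trans ct; rewrite arrival_mono.
  by apply/negbTE; rewrite -ltNge (lt_le_trans tc)// arrival_mono.
rewrite leE; congr (_ <= _)%N; rewrite /ring_count.
by apply/esym/card_fset_set; rewrite (_ : [set _ | _] = `I_c) //;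
  apply/seteqP; split=> j /=; rewrite leE.
Qed.

Lemma ring_countP t c : 0 <= t ->
  ring_count gap t = c <-> arrival gap c <= t < arrival gap c.+1.
Proof.
move=> t0; rewrite ltNge !arrival_le// -leqNgt -eqn_leq.
by split => [->|/eqP].
Qed.

Lemma ring_count0 : ring_count gap 0 = 0%N.
Proof. by apply/ring_countP; rewrite // arrivalS arrival0 add0r lexx gap_gt0. Qed.

End Clock.

Section Path.
Variables (R : realType) (n : nat) (gap : 'I_n -> nat -> R).
Hypothesis gap_gt0 : forall i k, 0 < gap i k.
Hypothesis unbounded : forall i (t : R), exists k, t < arrival (gap i) k.
Hypothesis not_simultaneous : forall i j k l, i != j ->
  arrival (gap i) k.+1 <> arrival (gap j) l.+1.

Let count t i := ring_count (gap i) t.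

Lemma previous_ring t : 0 <= t -> (exists i, 0 < count t i)%N ->
  exists i u, [/\ 0 <= u <= t, count t i = (count u i).+1 &
    forall j, j != i -> count u j = count t j].
Proof.
move=> t0 [i0 ci0]; pose a i := arrival (gap i) (count t i).
have aE i : a i <= t by rewrite /a arrival_le.
have a_gt0 i : (0 < count t i)%N -> 0 < a i.
  by move=> ci; rewrite -(arrival0 (gap i)); exact: arrival_homo.
case: (arg_maxP a (i0 := i0) (P := xpredT)) => // i _ amax.
have imax j : a j <= a i by exact: amax.
have ai0 : 0 < a i by exact: lt_le_trans (a_gt0 _ ci0) (imax _).
have ci : (0 < count t i)%N.
  by rewrite lt0n; apply: contraTneq ai0 => c0; rewrite /a c0 arrival0 ltxx.
have a_lt j : j != i -> a j < a i.
  move=> ji; rewrite lt_neqAle imax andbT; apply/eqP.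
  case cj : (count t j) => [|l]; rewrite {1}/a cj.
    by move=> a0; move: ai0; rewrite -a0 arrival0 ltxx.
  by rewrite /a -(prednK ci); apply: not_simultaneous.
pose b j := if j == i then arrival (gap i) (count t i).-1 else a j.
pose u := \big[Num.max/0]_j b j.
have bu j : b j <= u by rewrite /u; apply: le_bigmax.
have u0 : 0 <= u by rewrite /u; apply: bigmax_ge_id.
have ut : u < a i.
  apply: bigmax_lt => // j _; rewrite /b; case: eqP => [_|/eqP/a_lt//].
  by apply: arrival_homo => //; rewrite prednK.
have ule : u <= t by apply: ltW; exact: lt_le_trans ut (aE i).
exists i, u; split; first by rewrite u0.
  apply/eqP; rewrite eqn_leq; apply/andP; split.
    by rewrite -(prednK ci) ltnS -arrival_le//; have := bu i; rewrite /b eqxx.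
  by rewrite ltnNge -arrival_le// -ltNge.
move=> j ji; apply/eqP; rewrite eqn_leq -!arrival_le//.
have := bu j; rewrite /b (negbTE ji) => ->; rewrite andbT.
by rewrite (le_trans _ ule)// arrival_le.
Qed.

Lemma path_intermediate_value (s : 'I_n -> nat -> bool) (t : R) (v : nat) :
  let S u := (\sum_i s i (count u i))%N in
  0 <= t -> (S 0%R <= v <= S t)%N || (S t <= v <= S 0%R)%N ->
  exists2 u, 0 <= u <= t & S u = v.
Proof.
move=> S; move En: (\sum_i count t i)%N => N.
elim: N t En => [|N IH] t En t0 vS.
  exists 0; first by rewrite lexx.
  suff St : S t = S 0 by move: vS; rewrite St; move: (S 0) => x /orP[]/andP[]; lia.
  apply: eq_bigr => i _; rewrite {2}/count ring_count0//.
  by move/eqP: En; rewrite sum_nat_eq0 => /forallP/(_ i)/eqP->.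
have [i ci] : exists i, (0 < count t i)%N.
  apply/existsP; apply: contraTT isT => /existsPn c0.
  suff: (\sum_i count t i = 0)%N by rewrite En.
  by apply: big1 => i _; have := c0 i; lia.
have [|{ci}i [u [/andP[u0 ut] ci cj]]] := previous_ring t0; first by exists i.
have Su : (S u <= (S t).+1)%N && (S t <= (S u).+1)%N.
  have SE r : S r = (s i (count r i) + \sum_(j | j != i) s j (count r j))%N.
    by rewrite /S (bigD1 i).
  rewrite !SE (eq_bigr (fun j => nat_of_bool (s j (count t j)))).
    by case: (s _ _); case: (s _ _); rewrite /= ?add0n ?add1n ?leqnn ?leqnSn ?leqW.
  by move=> j /cj ->.
have [vt|vt] := eqVneq (S t) v; first by exists t; rewrite ?t0 ?lexx.
have [||w /andP[w0 wu] <-] := IH u _ u0.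
- move: En; rewrite (bigD1 i)//= ci addSn => -[<-]; rewrite [LHS](bigD1 i)//=.
  by congr (_ + _)%N; apply: eq_bigr => j /cj.
- move: vS Su vt; move: (S 0) (S t) (S u) => x y z.
  by move=> /orP[]/andP[? ?] /andP[? ?]; lia.
- by exists w; rewrite // w0 (le_trans wu).
Qed.

End Path.

(** * Independence of generated sigma-algebras *)

Section Independence.
Context (d : measure_display) (T : measurableType d) (R : realType).
Variable P : probability T R.
Local Open Scope ereal_scope.

Lemma independent_sigma (C : set (set T)) (B : set T) :
  setI_closed C -> C `<=` measurable -> measurable B ->
  (forall A, C A -> P (A `&` B) = P A * P B) ->
  forall A, <<s C >> A -> measurable A /\ P (A `&` B) = P A * P B.
Proof.
move=> CI Cm mB CB; apply: (lambda_system_subset CI); last by [].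
  apply/dynkin_lambda_system; split.
  - by rewrite setTI probability_setT mul1e; split=> //; exact: measurableT.
  - move=> A [mA AB]; split; first exact: measurableC.
    rewrite setIC -setDE measureD//; last by rewrite -ge0_fin_numE// fin_num_measure.
    transitivity (P B - P A * P B).
      by congr (_ - _); rewrite -AB; congr (P _); rewrite setIC.
    rewrite probability_setC// muleBl ?fin_num_measure//.
    by rewrite mul1e.
  - move=> F tF FB.
    have mF k : measurable (F k) by have [] := FB k.
    split; first exact: bigcupT_measurable.
    rewrite setI_bigcupl !measure_bigcup//; last 2 first.
    + by move=> k _; exact: measurableI.
    + by apply: trivIset_setIr.
    rewrite -(@fineK _ (P B)) ?fin_num_measure// muleC -nneseriesZl//.
    apply: eq_eseriesr => k _; rewrite fineK ?fin_num_measure// muleC.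
    by have [_ <-] := FB k.
by move=> A CA; split; [exact: Cm | exact: CB].
Qed.

Variables (I : choiceType) (G : I -> set (set T)).
Hypothesis G_measurable : forall i, G i `<=` measurable.
Hypothesis GI : forall i, setI_closed (G i).
Hypothesis GT : forall i, G i setT.
Hypothesis indepG : mutually_independent P G.

Definition cylinders (J : set I) : set (set T) :=
  [set A | exists (F : {fset I}) (B : I -> set T),
     (forall j, j \in F -> J j /\ G j (B j)) /\ A = \bigcap_(j in [set` F]) B j].

Lemma cylinders_measurable J : cylinders J `<=` measurable.
Proof.
move=> _ [F [B [FB ->]]]; apply: fin_bigcap_measurable; first exact: finite_fset.
by move=> j /= /FB[_ /G_measurable].
Qed.

Lemma cylinders_setI J : setI_closed (cylinders J).
Proof.
move=> _ _ [F [B [FB ->]]] [F' [B' [FB' ->]]].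
pose C (b : {fset I}) (D : I -> set T) j := if j \in b then D j else setT.
have CE b D : \bigcap_(j in [set` b]) D j = \bigcap_j C b D j.
  rewrite /C; apply/seteqP; split=> w h j /=.
    by case: ifP => // jb _; exact: h.
  by move=> /= jb; have := h j (Logic.I : setT j); rewrite jb.
exists (F `|` F')%fset, (fun j => C F B j `&` C F' B' j); split.
  move=> j; rewrite inE => jF; split.
    by case/orP: jF => [/FB[]|/FB'[]].
  by apply: GI; rewrite /C; case: ifPn => // jF'; [case: (FB j jF') | case: (FB' j jF')].
rewrite (CE F) (CE F') -bigcapI; apply/seteqP; split=> [w h j _|w h j _]; first exact: h.
have [jF|] := boolP (j \in (F `|` F')%fset); first exact: h.
by rewrite inE negb_or => /andP[/negbTE jF /negbTE jF']; rewrite /C jF jF'.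
Qed.

Lemma independent_disjoint (J K : set I) : J `&` K = set0 ->
  forall A B, <<s cylinders J >> A -> <<s cylinders K >> B ->
  [/\ measurable A, measurable B & P (A `&` B) = P A * P B].
Proof.
move=> JK0 A B sA sB.
have cylJK A' B' : cylinders J A' -> cylinders K B' -> P (A' `&` B') = P A' * P B'.
  move=> [F [C [FC ->]]] [F' [C' [FC' ->]]].
  have FF' j : j \in F -> j \in F' -> False.
    move=> /FC[Jj _] /FC'[Kj _].
    by suff : set0 j by []; rewrite -JK0.
  pose D j := if j \in F then C j else C' j.
  have DC j : j \in F -> D j = C j by rewrite /D => ->.
  have DC' j : j \in F' -> D j = C' j.
    by rewrite /D => jF'; case: ifP => // jF; case: (FF' j).
  rewrite [LHS](_ : _ = P (\bigcap_(j in [set` (F `|` F')%fset]) D j)); last first.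
    congr (P _); apply/seteqP; split=> [w [h h'] j /=|w h].
      by rewrite inE => /orP[] jF; rewrite ?(DC _ jF) ?(DC' _ jF); [exact: h|exact: h'].
    split=> j /= jF; first by rewrite -DC//; apply: h; rewrite /= inE jF.
    by rewrite -DC'//; apply: h; rewrite /= inE jF orbT.
  rewrite indepG => [|j]; last first.
    by rewrite inE => /orP[] jF; rewrite ?(DC _ jF) ?(DC' _ jF);
      [have [] := FC j jF | have [] := FC' j jF].
  rewrite (@indepG F) => [|j /FC[]//].
  rewrite (@indepG F') => [|j /FC'[]//].
  rewrite (perm_big (F ++ F')).
    rewrite big_cat /=; congr (_ * _); rewrite big_seq [RHS]big_seq.
      by apply: eq_bigr => j /DC ->.
    by apply: eq_bigr => j /DC' ->.
  apply: uniq_perm; rewrite ?fset_uniq//.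
    rewrite cat_uniq !fset_uniq/= andbT; apply/hasPn => j jF'.
    by apply/negP => jF; exact: (FF' j).
  by move=> j; rewrite mem_cat inE.
have mB : measurable B.
  have [||//] := independent_sigma (@cylinders_setI K)
    (@cylinders_measurable K) (B := setT) _ _ sB; first exact: measurableT.
  by move=> A' _; rewrite setIT probability_setT mule1.
have JB A' : cylinders J A' -> P (A' `&` B) = P A' * P B.
  move=> JA'; rewrite setIC muleC.
  apply: (independent_sigma (@cylinders_setI K) (@cylinders_measurable K) _ _ sB).2.
    exact: cylinders_measurable JA'.
  by move=> B' KB'; rewrite setIC muleC; exact: cylJK.
by have [] := independent_sigma (@cylinders_setI J) (@cylinders_measurable J) mB JB sA.
Qed.

End Independence.

(** * Anticoncentration of symmetric walks *)

Section Fourier.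
Variable R : realType.

Definition jump (x : bool * bool) : R := x.2%:R - x.1%:R.

Definition unit_phase (a : R) : R[i] := (cos a +i* sin a)%C.

Lemma unit_phaseD a b : unit_phase (a + b) = unit_phase a * unit_phase b.
Proof. by apply/eqP; rewrite eq_complex /= cosD sinD eqxx addrC eqxx. Qed.

Lemma unit_phase_sum (I : finType) (F : I -> R) :
  unit_phase (\sum_i F i) = \prod_i unit_phase (F i).
Proof.
by apply: (big_morph unit_phase unit_phaseD); rewrite /unit_phase cos0 sin0.
Qed.

Variables (n : nat) (law : 'I_n -> bool * bool -> R) (q : R).
Hypothesis law_ge0 : forall i x, 0 <= law i x.
Hypothesis law_up : forall i, law i (false, true) = q.
Hypothesis law_down : forall i, law i (true, false) = q.
Hypothesis law_stay : forall i, law i (true, true) + law i (false, false) = 1 - q *+ 2.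
Hypothesis q_ge0 : 0 <= q.
Hypothesis q_le : q <= 4^-1.

Definition weight (z : {ffun 'I_n -> bool * bool}) := \prod_i law i (z i).
Definition total (z : {ffun 'I_n -> bool * bool}) := \sum_i jump (z i).
Definition jump_cos (a : R) := 1 - q *+ 2 * (1 - cos a).

Lemma expectation_cos a :
  \sum_z weight z * cos (a * total z) = jump_cos a ^+ n.
Proof.
have -> : jump_cos a ^+ n =
    complex.Re (\prod_(i < n) \sum_x ((law i x)%:C * unit_phase (a * jump x)))%C.
  rewrite (eq_bigr (fun=> (jump_cos a)%:C%C)) => [|i _].
    by rewrite prodr_const card_ord -rmorphXn.
  transitivity (\sum_b \sum_c (law i (b, c))%:C * unit_phase (a * jump (b, c)))%C.
    by rewrite pair_bigA; apply: eq_bigr => -[].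
  rewrite !big_bool /jump /= law_up law_down !subrr subr0 sub0r.
  rewrite mulr0 mulr1 mulrN1 /unit_phase cosN sinN cos0 sin0.
  apply/eqP; rewrite eq_complex /=; apply/andP; split; apply/eqP; last by ring.
  rewrite /jump_cos; move: (law_stay i) => /(canRL (addrK _)) ->; ring.
rewrite bigA_distr_bigA raddf_sum /=; apply: eq_bigr => z _.
rewrite big_split /= -unit_phase_sum -mulr_sumr -rmorph_prod /=.
by rewrite mul0r subr0.
Qed.

Lemma weight_ge0 z : 0 <= weight z.
Proof. by apply: prodr_ge0. Qed.

Lemma jump_cos_ge0 a : 0 <= jump_cos a.
Proof.
have c1 : 0 <= 1 - cos a by rewrite subr_ge0 cos_le1.
have : (1 - cos a) * q <= (1 - cos a) * 4^-1 by rewrite ler_wpM2l.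
by rewrite /jump_cos; have := cos_geN1 a; lra.
Qed.

Lemma jump_cos_le1 a : jump_cos a <= 1.
Proof.
by rewrite /jump_cos lerBlDr lerDl mulr_ge0 ?mulrn_wge0// subr_ge0 cos_le1.
Qed.

Lemma cos_nonincreasing (a b : R) : 0 <= a -> a <= b -> b <= pi -> cos b <= cos a.
Proof.
move=> a0 ab bpi; rewrite leNgt ltr_cos ?in_itv/= -?leNgt//.
  by rewrite (le_trans a0).
by rewrite a0 (le_trans ab).
Qed.

Lemma jump_cos_le t a : 0 <= t -> t <= `|a| -> `|a| <= pi -> jump_cos a <= jump_cos t.
Proof.
move=> t0 ta api; have := cos_nonincreasing t0 ta api.
rewrite cos_norm /jump_cos => ca.
by rewrite lerD2l lerN2 ler_wpM2l ?mulrn_wge0// lerD2l lerN2.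
Qed.

Definition frequency (m L : nat) : R := acos 2^-1 / (2 * L.+1%:R * m.+1%:R).

(* For [t = frequency m L] the angles [(j + 1) t x], [j <= L], stay below
   [acos (1 / 2)] when [|x| <= m], so the square of [\sum_(j <= L) cos ((j + 1) t x)]
   is then at least [(L + 1)^2 / 4].  The mean of this square is a sum of Fourier
   coefficients [jump_cos a ^+ n], of which only the [L + 1] diagonal ones are not
   small. *)
Lemma anticoncentration (m L : nat) :
  \sum_(z | `|total z| <= m%:R) weight z
    <= 2 / L.+1%:R + 4 * jump_cos (frequency m L) ^+ n.
Proof.
set t := frequency m L; set eta := jump_cos t ^+ n; set N : R := L.+1%:R.
pose c0 : R := acos (2^-1).
have half : -1 <= (2^-1 : R) < 1 by apply/andP; split; lra.
have half_le1 : -1 <= (2^-1 : R) <= 1 by apply/andP; split; lra.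
have c0_gt0 : 0 < c0 by exact: acos_gt0.
have c0_le : c0 <= pi by exact: acos_lepi.
have cosc0 : cos c0 = 2^-1 by apply: acosK; rewrite in_itv.
have N_gt0 : 0 < N by rewrite ltr0n.
have t_gt0 : 0 < t by rewrite divr_gt0// !mulr_gt0.
have tE : t * (2 * N * m.+1%:R) = c0 by rewrite divfK// !mulf_neq0 ?gt_eqF.
move: t t_gt0 tE @eta => t t_gt0 tE eta.
have cos_ge (j : 'I_L.+1) x : `|x| <= m%:R -> 2^-1 <= cos (j.+1%:R * t * x).
  move=> xm; rewrite -cosc0 -[X in _ <= X]cos_norm.
  apply: cos_nonincreasing => //; rewrite !normrM normr_nat (gtr0_norm t_gt0).
  have jN : j.+1%:R <= N by rewrite ler_nat.
  have mS : m%:R <= m.+1%:R :> R by rewrite ler_nat.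
  have : j.+1%:R * t * `|x| <= N * t * m.+1%:R.
    by rewrite ler_pM ?mulr_ge0 ?(ltW t_gt0) ?ler_wpM2r ?(ltW t_gt0) ?(le_trans xm).
  move/le_trans; apply; rewrite -tE.
  by have := mulr_gt0 (mulr_gt0 N_gt0 t_gt0) (ltr0Sn R m); lra.
pose G (x : R) := (\sum_(j < L.+1) cos (j.+1%:R * t * x)) ^+ 2.
have G_ge x : `|x| <= m%:R -> N ^+ 2 / 4 <= G x.
  move=> xm; have -> : N ^+ 2 / 4 = (\sum_(j < L.+1) 2^-1) ^+ 2.
    by rewrite sumr_const card_ord -[_ *+ L.+1]mulr_natr -/N; field.
  have le_sum : \sum_(j < L.+1) 2^-1 <= \sum_(j < L.+1) cos (j.+1%:R * t * x).
    by apply: ler_sum => j _; exact: cos_ge.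
  have sum_ge0 : 0 <= \sum_(j < L.+1) 2^-1 :> R by apply: sumr_ge0.
  by rewrite lerXn2r ?nnegrE ?(le_trans sum_ge0).
have G_mean : \sum_z weight z * G (total z) <= N ^+ 2 * eta + N / 2.
  have diag (j k : 'I_L.+1) : jump_cos ((j.+1%:R + k.+1%:R) * t) ^+ n
      + jump_cos ((j.+1%:R - k.+1%:R) * t) ^+ n <= 2 * eta + (j == k)%:R.
    have pow_le a : t <= `|a| -> `|a| <= pi -> jump_cos a ^+ n <= eta.
      by move=> ta ap; rewrite /eta lerXn2r ?nnegrE ?jump_cos_ge0// jump_cos_le// ltW.
    have jN : j.+1%:R <= N by rewrite ler_nat.
    have kN : k.+1%:R <= N by rewrite ler_nat.
    have j1 : 1 <= j.+1%:R :> R by rewrite ler1n.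
    have k1 : 1 <= k.+1%:R :> R by rewrite ler1n.
    have m1 : 1 <= m.+1%:R :> R by rewrite ler1n.
    have tN : 2 * N * t <= pi.
      apply: le_trans c0_le; rewrite -tE mulrA [leLHS]mulrC ler_peMr//.
      by rewrite !mulr_ge0// ltW.
    have absE y : `|y * t| = `|y| * t by rewrite normrM (gtr0_norm t_gt0).
    have le_pi y : `|y| <= 2 * N -> `|y * t| <= pi.
      by move=> yN; rewrite absE; apply: le_trans tN; rewrite ler_wpM2r// ltW.
    have ge_t y : 1 <= `|y| -> t <= `|y * t|.
      by move=> y1; rewrite absE ler_peMl// ltW.
    have sum_le : jump_cos ((j.+1%:R + k.+1%:R) * t) ^+ n <= eta.
      by apply: pow_le; [apply: ge_t | apply: le_pi]; rewrite ger0_norm; lra.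
    move: sum_le; have [->|jk] := eqVneq j k => sum_le.
      have : jump_cos ((k.+1%:R - k.+1%:R) * t) ^+ n <= 1.
        by rewrite exprn_ile1 ?jump_cos_ge0 ?jump_cos_le1.
      have : 0 <= eta by rewrite exprn_ge0 ?jump_cos_ge0.
      by move: sum_le => /=; lra.
    suff : jump_cos ((j.+1%:R - k.+1%:R) * t) ^+ n <= eta by rewrite /= addr0; lra.
    apply: pow_le; [apply: ge_t | apply: le_pi; rewrite ler_norml; apply/andP; split; lra].
    case: (ltngtP j k) jk => [jk _|jk _|/val_inj->]; last by rewrite eqxx.
      rewrite distrC ger0_norm ?subr_ge0 ?ler_nat ?ltnS; last exact: ltnW.
      by rewrite lerBrDl natr1 ler_nat.
    rewrite ger0_norm ?subr_ge0 ?ler_nat ?ltnS; last exact: ltnW.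
    by rewrite lerBrDl natr1 ler_nat.
  have -> : \sum_z weight z * G (total z) = 2^-1 * \sum_(j < L.+1) \sum_(k < L.+1)
     (jump_cos ((j.+1%:R + k.+1%:R) * t) ^+ n + jump_cos ((j.+1%:R - k.+1%:R) * t) ^+ n).
    have GE x : G x = \sum_(j < L.+1) \sum_(k < L.+1) 2^-1 *
        (cos ((j.+1%:R + k.+1%:R) * t * x) + cos ((j.+1%:R - k.+1%:R) * t * x)).
      rewrite /G expr2 mulr_suml; apply: eq_bigr => j _.
      rewrite mulr_sumr; apply: eq_bigr => k _.
      by rewrite !mulrDl !mulNr cosD cosB; lra.
    transitivity (\sum_z \sum_(j < L.+1) \sum_(k < L.+1) weight z * (2^-1 *
        (cos ((j.+1%:R + k.+1%:R) * t * total z) + cos ((j.+1%:R - k.+1%:R) * t * total z)))).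
      apply: eq_bigr => z _; rewrite GE mulr_sumr; apply: eq_bigr => j _.
      by rewrite mulr_sumr.
    rewrite exchange_big mulr_sumr; apply: eq_bigr => j _ /=.
    rewrite exchange_big mulr_sumr; apply: eq_bigr => k _ /=.
    rewrite -!expectation_cos -big_split mulr_sumr; apply: eq_bigr => z _ /=.
    by rewrite -mulrDr mulrCA.
  apply: (@le_trans _ _ (2^-1 * \sum_(j < L.+1) \sum_(k < L.+1) (2 * eta + (j == k)%:R))).
    by rewrite ler_wpM2l ?invr_ge0// ; do 2!(apply: ler_sum => ? _).
  have row (j : 'I_L.+1) : \sum_(k < L.+1) (2 * eta + (j == k)%:R) = 2 * eta * N + 1.
    rewrite big_split/= sumr_const card_ord -[_ *+ L.+1]mulr_natr (bigD1 j)//= eqxx.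
    by rewrite big1 ?addr0// => k; rewrite eq_sym => /negbTE ->.
  rewrite (eq_bigr _ (fun j _ => row j)) sumr_const card_ord -[_ *+ L.+1]mulr_natr -/N.
  by rewrite expr2; lra.
have G_ge0 x : 0 <= G x by apply: sqr_ge0.
have : (\sum_(z | `|total z| <= m%:R) weight z) * (N ^+ 2 / 4) <= N ^+ 2 * eta + N / 2.
  apply: le_trans G_mean; rewrite mulr_suml big_mkcond /=; apply: ler_sum => z _.
  by case: ifP => [/G_ge zm|_]; [rewrite ler_wpM2l ?weight_ge0 | rewrite mulr_ge0 ?weight_ge0].
rewrite -ler_pdivlMr; last by rewrite divr_gt0// exprn_gt0.
move=> /le_trans; apply; rewrite le_eqVlt; apply/orP; left; apply/eqP.
by field; rewrite gt_eqF.
Qed.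

Lemma jump_cos_expn_le a :
  jump_cos a ^+ n <= (1 + n%:R * q * (2 * (1 - cos a)))^-1.
Proof.
have c1 : 0 <= 1 - cos a by rewrite subr_ge0 cos_le1.
have x0 : 0 <= q * (2 * (1 - cos a)) by rewrite !mulr_ge0.
apply: (@le_trans _ _ (expR (- (q * (2 * (1 - cos a)))) ^+ n)).
  rewrite lerXn2r ?nnegrE ?jump_cos_ge0 ?expR_ge0//.
  by apply: le_trans (expR_ge1Dx _); rewrite /jump_cos; lra.
rewrite -expRM_natl mulrN expRN lef_pV2 ?posrE ?expR_gt0//.
  by apply: le_trans (expR_ge1Dx _); rewrite -(mulrA n%:R) lexx.
by have := mulr_ge0 (ler0n R n) x0; lra.
Qed.

End Fourier.

Lemma anticoncentration_uniform (R : realType) (m : nat) (eps : R) : 0 < eps ->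
  exists K : R, forall (n : nat) (law : 'I_n -> bool * bool -> R) (q : R),
    (forall i x, 0 <= law i x) ->
    (forall i, law i (false, true) = q) -> (forall i, law i (true, false) = q) ->
    (forall i, law i (true, true) + law i (false, false) = 1 - q *+ 2) ->
    0 <= q <= 4^-1 -> K <= n%:R * q ->
    \sum_(z : {ffun 'I_n -> bool * bool} | `|total R z| <= m%:R) weight law z <= eps.
Proof.
move=> eps0; pose L := Num.truncn (4 / eps).
set t := frequency R m L.
pose kappa := 2 * (1 - cos t).
have t_gt0 : 0 < t.
  by rewrite /t /frequency divr_gt0// ?mulr_gt0//; apply: acos_gt0; apply/andP; split; lra.
have t_le : t <= pi.
  apply: (@le_trans _ _ (acos 2^-1)); last by apply: acos_lepi; apply/andP; split; lra.
  rewrite ler_pdivrMr ?mulr_gt0// ler_peMr ?acos_ge0//; first by apply/andP; split; lra.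
  have L1 : 1 <= L.+1%:R :> R by rewrite ler1n.
  have m1 : 1 <= m.+1%:R :> R by rewrite ler1n.
  nra.
have kappa_gt0 : 0 < kappa.
  rewrite mulr_gt0// subr_gt0 -cos0 ltr_cos// in_itv/= ?lexx ?pi_ge0//.
  by rewrite (ltW t_gt0).
exists (8 / (eps * kappa)) => n law q law0 lu ld ls /andP[q0 q4] Kq.
apply: le_trans (anticoncentration law0 lu ld ls q0 q4 m L) _.
have L_le : 2 / L.+1%:R <= eps / 2.
  have /ltW : 4 / eps < L.+1%:R by apply: truncnS_gt.
  by rewrite !ler_pdivrMr ?ltr0n// => h; lra.
have jump_le := jump_cos_expn_le n q0 q4 t; rewrite -/kappa in jump_le.
suff : 4 * (1 + n%:R * q * kappa)^-1 <= eps / 2.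
  move=> h; rewrite [leRHS](splitr eps) lerD// (le_trans _ h)//.
  by rewrite ler_wpM2l.
have nq : 8 <= eps * (n%:R * q * kappa).
  move: Kq; rewrite ler_pdivrMr ?(mulr_gt0 eps0 kappa_gt0)// => /le_trans; apply.
  by rewrite le_eqVlt; apply/orP; left; apply/eqP; ring.
have := mulr_ge0 (mulr_ge0 (ler0n R n) q0) (ltW kappa_gt0) => nqk.
by rewrite ler_pdivrMr; lra.
Qed.

(** * The law of the dynamics *)

Section ClockMeasurability.
Context (R : realType) (d : measure_display) (T : measurableType d).
Variable gap : nat -> T -> R.

Lemma measurable_arrival m : (forall k, (k < m)%N -> measurable_fun setT (gap k)) ->
  measurable_fun setT (fun w => arrival (gap ^~ w) m).
Proof.
by move=> mgap; apply: (@measurable_sum _ _ _ _ _ _ (fun k : 'I_m => gap k)) => k; exact: mgap.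
Qed.

Hypothesis measurable_gap : forall k, measurable_fun setT (gap k).
Hypothesis gap_gt0 : forall k w, 0 < gap k w.
Hypothesis unbounded : forall w (t : R), exists k, t < arrival (gap ^~ w) k.

Lemma measurable_ring_count t c : 0 <= t ->
  measurable [set w | ring_count (gap ^~ w) t = c].
Proof.
move=> t0.
have -> : [set w | ring_count (gap ^~ w) t = c] =
    (fun w => arrival (gap ^~ w) c) @^-1` `]-oo, t] `&`
    (fun w => arrival (gap ^~ w) c.+1) @^-1` `]t, +oo[.
  have cE w := ring_countP (gap_gt0^~ w) (@unbounded w) c t0.
  apply/seteqP; split=> w /=; rewrite !in_itv/= andbT; first by move/cE => /andP[].
  by move=> -[ct tc]; apply/cE; rewrite ct tc.
by apply: measurableI; rewrite -[X in measurable X]setTI;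
  apply: measurable_arrival => //; exact: measurable_itv.
Qed.

End ClockMeasurability.

Section Process.
Variables (R : realType) (n : nat) (p : R) (X : dynamics n p).
Local Notation P := (prob X).
Local Notation index := (('I_n * nat) + ('I_n * nat))%type.

Let pos i w k : 0 < gap X i k w := gap_gt0 i k w.
Let unb i w := @arrival_unbounded R n p X i w.

Definition source (j : index) : set (set (sample X)) :=
  match j with
  | inl (i, k) => preimage_set_system setT (gap X i k) measurable
  | inr (i, k) => preimage_set_system setT (spin X i k) measurable
  end.

Lemma source_measurable j : source j `<=` measurable.
Proof. by case: j => -[i k] _ [B mB <-]; exact: measurable_funPT. Qed.

Lemma source_setI j : setI_closed (source j).
Proof.
by case: j => -[i k] _ _ [B mB <-] [C mC <-]; exists (B `&` C);
  rewrite ?preimage_setI ?setTI//; exact: measurableI.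
Qed.

Lemma source_setT j : source j setT.
Proof. by case: j => -[i k]; exists setT; rewrite ?preimage_setT ?setTI. Qed.

Definition generated (J : set index) := <<s cylinders source J >>.
Definition generatedType (J : set index) := g_sigma_algebraType (cylinders source J).

Lemma source_generated (J : set index) j : J j -> source j `<=` generated J.
Proof.
move=> Jj A jA; apply: sub_sigma_algebra; exists [fset j]%fset, (fun=> A).
split; first by move=> _ /fset1P ->.
by rewrite set_fset1 bigcap_set1.
Qed.

Lemma generatedS (J K : set index) : J `<=` K -> generated J `<=` generated K.
Proof.
move=> JK; apply: sub_sigma_algebra2 => A [F [B [FB ->]]]; exists F, B.
by split=> // j /FB[/JK].
Qed.

Lemma generated_independent (J K : set index) A B : J `&` K = set0 ->
  generated J A -> generated K B ->
  [/\ measurable A, measurable B & (P (A `&` B) = P A * P B)%E].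
Proof.
move=> JK; apply: (independent_disjoint _ _ _ (@gap_spin_independent _ _ _ X)) => //.
- exact: source_measurable.
- exact: source_setI.
- exact: source_setT.
Qed.

Lemma generated_measurable J A : generated J A -> measurable A.
Proof.
move=> JA; have [||] := @generated_independent J set0 A set0 _ JA; rewrite ?setI0//.
by apply: sigma_algebra0.
Qed.

Lemma measurable_gap (J : set index) i k : J (inl (i, k)) ->
  measurable_fun setT (gap X i k : generatedType J -> R).
Proof. by move=> Jj _ B mB; apply: (source_generated Jj); exists B. Qed.

Definition count (i : 'I_n) (t : R) (w : sample X) := ring_count (gap X i ^~ w) t.

Lemma count_generated (J : set index) i t k : 0 <= t -> (forall l, J (inl (i, l))) ->
  generated J [set w | count i t w = k].
Proof.
move=> t0 Ji; apply: (@measurable_ring_count R _ (generatedType J) (gap X i)) => //.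
by move=> l; exact: measurable_gap.
Qed.

Lemma spin_generated (J : set index) i k b : J (inr (i, k)) ->
  generated J [set w | spin X i k w = b].
Proof.
by move=> Jj; apply: (source_generated Jj); exists [set b]; rewrite ?setTI.
Qed.

Lemma generated_setT J : generated J setT.
Proof. exact: (@measurableT _ (generatedType J)). Qed.

Lemma generatedI J A B : generated J A -> generated J B -> generated J (A `&` B).
Proof. exact: (@measurableI _ (generatedType J)). Qed.

Lemma generated_bigcup J (F : nat -> set (sample X)) :
  (forall k, generated J (F k)) -> generated J (\bigcup_k F k).
Proof. exact: (@bigcupT_measurable _ (generatedType J)). Qed.

Lemma state0 w : state (X := X) 0 w = [ffun i => spin X i 0 w].
Proof. by apply/ffunP => i; rewrite !ffunE ring_count0//; exact: unb. Qed.

Definition pair_event (t : R) (i : 'I_n) (x : bool * bool) : set (sample X) :=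
  [set w | spin X i 0 w = x.1 /\ spin X i (count i t w) w = x.2].

Definition coordinate (j : index) := match j with inl (i, _) | inr (i, _) => i end.

Lemma pair_event_bigcup t i x : pair_event t i x =
  \bigcup_k ([set w | spin X i 0 w = x.1] `&` [set w | spin X i k w = x.2]
    `&` [set w | count i t w = k]).
Proof.
apply/seteqP; split=> [w [x1 x2]|w [k _ [[x1 x2] ck]]]; first by exists (count i t w).
by split => //; rewrite ck.
Qed.

Lemma pair_event_generated t i x : 0 <= t ->
  generated [set j | coordinate j = i] (pair_event t i x).
Proof.
move=> t0; rewrite pair_event_bigcup; apply: generated_bigcup => k.
by do 2?apply: generatedI; [exact: spin_generated..|exact: count_generated].
Qed.

End Process.

Section FiniteValued.
Context (R : realType) (d : measure_display) (T : measurableType d).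
Variable P : probability T R.
Variables (W : finType) (h : T -> W).
Hypothesis measurable_fiber : forall x, measurable [set w | h w = x].
Local Open Scope ereal_scope.

Lemma measurable_finite_valued (D : set W) : measurable [set w | D (h w)].
Proof.
have -> : [set w | D (h w)] = \bigcup_(x in D) [set w | h w = x].
  by apply/seteqP; split=> [w Dw|w [x Dx /= ->]//]; exists (h w).
by apply: fin_bigcup_measurable => //; exact: finite_finset.
Qed.

Lemma probability_finite_valued (D : pred W) :
  P [set w | D (h w)] = \sum_(x | D x) P [set w | h w = x].
Proof.
rewrite -big_filter; set s := [seq x <- index_enum W | D x].
have -> : [set w | D (h w)] = [set w | h w \in s].
  by apply/seteqP; split=> w /=; rewrite mem_filter mem_index_enum andbT.
have: uniq s by rewrite filter_uniq// index_enum_uniq.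
elim: s => [|x s IH] /=.
  rewrite big_nil; transitivity (P set0); last exact: measure0.
  by congr (P _); apply/seteqP; split.
move=> /andP[xs us]; rewrite big_cons -IH//.
have ms : measurable [set w | h w \in s] := measurable_finite_valued [set` s].
rewrite -measureU//.
  congr (P _); apply/seteqP; split=> w /=; rewrite inE.
    by case/orP => [/eqP|]; [left|right].
  by case=> [->|->]; rewrite ?eqxx ?orbT.
by apply/seteqP; split=> // w [/= ->]; rewrite (negbTE xs).
Qed.

End FiniteValued.

Section Law.
Variables (R : realType) (n : nat) (p : R) (X : dynamics n p).
Local Notation P := (prob X).

Lemma independent_coordinates (A : 'I_n -> set (sample X)) :
  (forall i, generated [set j | coordinate j = i] (A i)) ->
  P (\bigcap_i A i) = (\prod_i P (A i))%E.
Proof.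
move=> gA; have -> : \bigcap_i A i = \bigcap_(i in [set` index_enum 'I_n]) A i.
  by apply/seteqP; split=> w h i _; apply: h => //=; rewrite mem_index_enum.
have := index_enum_uniq 'I_n.
suff : forall s : seq 'I_n, uniq s ->
    generated [set j | coordinate j \in s] (\bigcap_(i in [set` s]) A i)
    /\ P (\bigcap_(i in [set` s]) A i) = (\prod_(i <- s) P (A i))%E by move=> h /h[].
elim=> [_|i s IH /= /andP[ins /IH[gs Ps]]].
  rewrite big_nil (_ : \bigcap_(i in _) _ = setT); last by apply/seteqP; split.
  rewrite probability_setT; split=> //.
  exact: generated_setT.
have -> : \bigcap_(j in [set` i :: s]) A j = A i `&` \bigcap_(j in [set` s]) A j.
  apply/seteqP; split=> [w h|w [wi h] j /=].
    by split=> [|j js]; apply: h; rewrite /= inE ?eqxx// (_ : j \in s) ?orbT.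
  by rewrite inE => /predU1P[->//|]; exact: h.
rewrite big_cons -Ps; split.
  apply: generatedI; first by apply: generatedS (gA i) => j /= ->; rewrite inE eqxx.
  by apply: generatedS gs => j /=; rewrite inE orbC => ->.
by have [] := generated_independent _ (gA i) gs;
  rewrite // -subset0 => j /= [->]; rewrite (negbTE ins).
Qed.

Hypothesis p01 : 0 <= p <= 1.

Lemma probability_spin i k b : P [set w | spin X i k w = b] = (if b then p else 1 - p)%:E.
Proof.
transitivity (distribution P (spin X i k) [set b]) => //.
rewrite spin_bernoulli bernoulli_probE// !diracE.
case: b; [rewrite [true \in _]mem_set// [false \in _]memNset// |
  rewrite [false \in _]mem_set// [true \in _]memNset//].
  by rewrite mule1 mule0 adde0.
by rewrite mule1 mule0 add0e.
Qed.

Lemma probability_ring i t : 0 < t ->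
  P [set w | (0 < count i t w)%N] = (1 - expR (- t))%:E.
Proof.
move=> t0; transitivity (distribution P (gap X i 0) `[0, t]).
  have gapE w : (gap X i 0 w <= t) = (0 < count i t w)%N.
    have := arrival_le (fun k => @gap_gt0 _ _ _ X i k w)
      (@arrival_unbounded _ _ _ X i w) 1 (ltW t0).
    by rewrite arrivalS arrival0 add0r.
  by congr (P _); apply/seteqP; split=> w /=; rewrite in_itv/= (ltW (gap_gt0 _ _ _)) gapE.
by rewrite gap_exponential// exponential_prob_itv0c// mulN1r.
Qed.

Lemma probability_spin_change i t x : 0 < t -> x.1 != x.2 ->
  P (pair_event t i x) = (p * (1 - p) * (1 - expR (- t)))%:E.
Proof.
move=> t0 x12; have t_ge0 := ltW t0.
set c : R := p * (1 - p).
pose A k := [set w | spin X i 0 w = x.1] `&` [set w | spin X i k w = x.2]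
  `&` [set w | count i t w = k].
have countm k : generated [set j | if j is inl (i', _) then i' = i else False]
    [set w : sample X | count i t w = k] by exact: count_generated.
have AE k : P (A k) =
    (c%:E * P ([set w | count i t w = k] `&` [set w | (0 < count i t w)%N]))%E.
  case: k => [|k].
    rewrite /A (_ : _ `&` _ = set0); last first.
      by apply/seteqP; split=> // w [[/= x1 x2] _]; rewrite -x1 -x2 eqxx in x12.
    rewrite (_ : [set w | count i t w = 0%N] `&` _ = set0) ?measure0 ?mule0//.
    by apply/seteqP; split=> // w [/= ->].
  rewrite [in RHS](_ : _ `&` _ = [set w | count i t w = k.+1]); last first.
    by apply/seteqP; split=> [w []//|w /= ck]; rewrite ck.
  pose J l : set (('I_n * nat) + ('I_n * nat)) := [set inr (i, l)].
  have spinm l b : generated (J l) [set w : sample X | spin X i l w = b].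
    exact: spin_generated.
  have spins : generated (J 0%N `|` J k.+1)
      ([set w : sample X | spin X i 0 w = x.1] `&` [set w | spin X i k.+1 w = x.2]).
    apply: generatedI.
      by apply: generatedS (spinm 0%N x.1) => j ?; left.
    by apply: generatedS (spinm k.+1 x.2) => j ?; right.
  have [|_ _ ->] := generated_independent _ spins (countm k.+1).
    by rewrite -subset0 => j [[|] /= ->].
  congr (_ * _)%E.
  have [|_ _ ->] := generated_independent _ (spinm 0%N x.1) (spinm k.+1 x.2).
    by rewrite -subset0 => j [/= ->].
  rewrite !probability_spin -EFinM /c; congr (_%:E).
  by move: x12; case: (x) => [[] []] //= _; rewrite mulrC.
have mcount k : measurable [set w : sample X | count i t w = k].
  exact: generated_measurable (countm k).
have mring : measurable [set w : sample X | (0 < count i t w)%N].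
  have := measurableC (mcount 0%N); congr (measurable _).
  by apply/seteqP; split=> w /=; rewrite lt0n => /eqP.
have mspin l b : measurable [set w : sample X | spin X i l w = b].
  by apply: (@generated_measurable _ _ _ _ setT); exact: spin_generated.
have triv B : trivIset setT (fun k => B k `&` [set w : sample X | count i t w = k]).
  apply/trivIsetP => k l _ _ kl; rewrite -subset0 => w [[_ /= ck] [_ /= cl]].
  by rewrite -ck -cl eqxx in kl.
rewrite EFinM -(probability_ring i t0) -/c pair_event_bigcup.
rewrite measure_bigcup//; last by move=> k _; do 2?apply: measurableI.
rewrite (eq_eseriesr (fun k _ => AE k)) nneseriesZl//; congr (_ * _)%E.
rewrite -(@measure_bigcup _ _ _ _ setT); last 2 first.
- by move=> k _; exact: measurableI.
- by under eq_fun do rewrite setIC; exact: triv.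
by congr (P _); apply/seteqP; split=> [w [k _ []//]|w w0]; exists (count i t w).
Qed.

End Law.

Definition ones (n : nat) (x : cube n) : nat := (\sum_i x i)%N.

Section Displacement.
Variables (R : realType) (n : nat) (p : R) (X : dynamics n p) (t : R).
Hypothesis p01 : 0 <= p <= 1.
Hypothesis t_gt0 : 0 < t.
Local Notation P := (prob X).

Let law i x : R := fine (P (pair_event t i x)).
Let endpoints (w : sample X) : {ffun 'I_n -> bool * bool} :=
  [ffun i => (spin X i 0 w, spin X i (count i t w) w)].

Lemma pair_event_measurable i x : measurable (pair_event (X := X) t i x).
Proof. by apply: generated_measurable; apply: pair_event_generated; exact: ltW. Qed.

Lemma endpoints_fiber z : [set w | endpoints w = z] = \bigcap_i pair_event t i (z i).
Proof.
apply/seteqP; split=> [w /= <- i _|w h]; first by rewrite ffunE.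
by apply/ffunP => i; rewrite ffunE; have [/= -> ->] := h i Logic.I; case: (z i).
Qed.

Lemma measurable_endpoints z : measurable [set w | endpoints w = z].
Proof.
by rewrite endpoints_fiber; apply: fin_bigcap_measurable => *;
  [exact: finite_finset | exact: pair_event_measurable].
Qed.

Lemma probability_endpoints z : P [set w | endpoints w = z] = (weight law z)%:E.
Proof.
rewrite endpoints_fiber independent_coordinates//; last first.
  by move=> i; apply: pair_event_generated; exact: ltW.
rewrite /weight -prodEFin; apply: eq_bigr => i _.
by rewrite /law fineK// fin_num_measure//; exact: pair_event_measurable.
Qed.

Lemma law_total i : \sum_x law i x = 1.
Proof.
apply: EFin_inj; rewrite -sumEFin -(@probability_setT _ _ _ P).
rewrite (_ : [set: _] = [set w | predT (spin X i 0 w, spin X i (count i t w) w)]); last first.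
  by apply/seteqP; split.
pose h (w : sample X) := (spin X i 0 w, spin X i (count i t w) w).
have hE x : [set w | h w = x] = pair_event t i x.
  case: x => a b; apply/seteqP; split=> w /=; first by case=> <- <-.
  by case=> /= <- <-.
rewrite (@probability_finite_valued _ _ _ P _ h) => [|x]; last first.
  by rewrite hE; exact: pair_event_measurable.
apply: eq_bigr => x _; rewrite hE /law fineK// fin_num_measure//.
exact: pair_event_measurable.
Qed.

Lemma total_endpoints w :
  total R (endpoints w) = (ones (state t w))%:R - (ones (state 0 w))%:R.
Proof.
rewrite /total /ones !natr_sum -sumrB; apply: eq_bigr => i _.
by rewrite state0 !ffunE.
Qed.

Let flip_rate : R := p * (1 - p) * (1 - expR (- t)).

Lemma law_change i x : x.1 != x.2 -> law i x = flip_rate.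
Proof. by move=> x12; rewrite /law probability_spin_change. Qed.

Lemma flip_rate_itv : 0 <= flip_rate <= 4^-1.
Proof.
have /andP[p0 p1] := p01.
have e1 : expR (- t) <= 1 by rewrite -expR0 ler_expR oppr_le0 ltW.
have e0 := expR_ge0 (- t).
have pp : p * (1 - p) <= 4^-1 by have := sqr_ge0 (p - 2^-1); nra.
have pp0 : 0 <= p * (1 - p) by rewrite mulr_ge0// subr_ge0.
by rewrite mulr_ge0 ?subr_ge0//= (le_trans _ pp)// ler_piMr// gerBl.
Qed.

Lemma probability_displacement (D : pred R) :
  P [set w | D ((ones (state t w))%:R - (ones (state 0 w))%:R)] =
  (\sum_(z | D (total R z)) weight law z)%:E.
Proof.
rewrite (_ : [set w | _] = [set w | D (total R (endpoints w))]); last first.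
  by apply/seteqP; split=> w /=; rewrite total_endpoints.
rewrite (@probability_finite_valued _ _ _ P _ endpoints
  measurable_endpoints (fun z => D (total R z))) -sumEFin.
by apply: eq_bigr => z _; rewrite probability_endpoints.
Qed.

End Displacement.

Lemma displacement_unlikely (R : realType) (m : nat) (t eps : R) :
  0 < t -> 0 < eps ->
  exists K : R, forall (n : nat) (p : R) (X : dynamics n p), 0 <= p <= 1 ->
    K <= n%:R * p * (1 - p) ->
    (prob X [set w | (`|(ones (state t w))%:R - (ones (state 0 w))%:R| <= m%:R :> R)%R]
      <= eps%:E)%E.
Proof.
move=> t0 eps0; have [K Kle] := @anticoncentration_uniform R m eps eps0.
have e1 : 0 < 1 - expR (- t) by rewrite subr_gt0 -expR0 ltr_expR oppr_lt0.
exists (K / (1 - expR (- t))) => n p X p01 Kn.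
rewrite (@probability_displacement R n p X t t0 (fun y => `|y| <= m%:R)) lee_fin.
apply: (Kle n _ (p * (1 - p) * (1 - expR (- t)))).
- by move=> i x; rewrite fine_ge0.
- by move=> i; exact: law_change.
- by move=> i; exact: law_change.
- move=> i; have := @law_total R n p X t t0 i.
  rewrite (eq_bigr (fun x => fine (prob X (pair_event t i (x.1, x.2))))) => [|[]//].
  rewrite -(pair_bigA _ (fun b c => fine (prob X (pair_event t i (b, c)))))/=.
  rewrite !big_bool /=.
  have := @law_change R n p X t p01 t0 i (true, false) isT.
  by have := @law_change R n p X t p01 t0 i (false, true) isT; lra.
- exact: flip_rate_itv.
- by move: Kn; rewrite ler_pdivrMr// => /le_trans; apply; rewrite !mulrA.
Qed.

(** * Simultaneous rings *)

Section SimultaneousRings.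
Variables (R : realType) (n : nat) (p : R) (X : dynamics n p).
Local Notation P := (prob X).
Local Notation ring_time i k w := (arrival (gap X i ^~ w) k).

Lemma exponential_interval_le (a b : R) : a <= b ->
  (exponential_prob 1 `[a, b[ <= (b - a)%:E)%E.
Proof.
move=> ab; rewrite /exponential_prob.
apply: (@le_trans _ _ (\int[lebesgue_measure]_(x in `[a, b[) 1)%E).
  apply: ge0_le_integral => //.
  - by move=> x _; rewrite lee_fin exponential_pdf_ge0.
  - by apply/measurable_EFinP; apply: measurable_funTS; exact: measurable_exponential_pdf.
  - move=> x _; rewrite lee_fin; have [x0|x0] := ltP x 0.
      by rewrite lt0_exponential_pdf.
    by rewrite exponential_pdfE// mul1r mulN1r -expR0 ler_expR oppr_le0.
rewrite integral_cst// mul1e /= lebesgue_measure_itv/= lte_fin.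
by case: ifP => _; rewrite ?EFinB// lee_fin subr_ge0.
Qed.

Lemma measurable_simultaneous i j k l :
  measurable [set w : sample X | ring_time i k w = ring_time j l w].
Proof.
have mring i' k' : measurable_fun setT (fun w : sample X => ring_time i' k' w).
  by apply: measurable_arrival => k'' _; exact: measurable_funPT.
have := measurable_funB (mring i k) (mring j l) measurableT (@measurable_set1 R 0).
rewrite setTI; congr (measurable _); apply/seteqP; split=> w /=.
  by move/subr0_eq.
by move=> ->; rewrite subrr.
Qed.

(* The last gap [Y = gap i k] is independent of the value [Z] it must take, and its
   density is at most 1: on a grid of mesh [1 / (N + 1)], it falls into the same
   cell as [Z] with probability at most [1 / (N + 1)]. *)
Lemma simultaneous_negligible i j k l : i != j ->
  P [set w | ring_time i k.+1 w = ring_time j l.+1 w] = 0%E.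
Proof.
move=> ij; set S := [set w | _].
pose J : set (('I_n * nat) + ('I_n * nat)) := [set inl (i, k)].
pose Z (w : sample X) := ring_time j l.+1 w - ring_time i k w.
have mY : measurable_fun setT (gap X i k : generatedType X J -> R) by exact: measurable_gap.
have mZ : measurable_fun setT (Z : generatedType X (~` J) -> R).
  apply: measurable_funB; apply: measurable_arrival => m ml; apply: measurable_gap.
    by move=> [ji _]; rewrite ji eqxx in ij.
  by move=> [mk]; rewrite mk ltnn in ml.
have mS : measurable S by exact: measurable_simultaneous.
suff SN (N : nat) : (P S <= (N.+1%:R^-1)%:E)%E.
  apply/eqP; rewrite eq_le measure_ge0 andbT; apply/lee_addgt0Pr => e e0; rewrite add0e.
  apply: le_trans (SN (Num.truncn e^-1)) _; rewrite lee_fin invf_ple ?posrE//.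
  by rewrite ltW// truncnS_gt.
have N0 : (0 : R) < N.+1%:R by rewrite ltr0n.
pose B m : set R := `[m%:R / N.+1%:R, m.+1%:R / N.+1%:R[%classic.
pose BY m : set (sample X) := gap X i k @^-1` (B m).
pose BZ m : set (sample X) := Z @^-1` (B m).
have gY m : generated J (BY m).
  by rewrite -[BY m]setTI; apply: mY => //; exact: measurable_itv.
have gZ m : generated (~` J) (BZ m).
  by rewrite -[BZ m]setTI; apply: mZ => //; exact: measurable_itv.
have YZ m : [/\ measurable (BY m), measurable (BZ m) &
    (P (BY m `&` BZ m) = P (BY m) * P (BZ m))%E].
  by apply: (generated_independent _ (gY m) (gZ m)); rewrite setICr.
have PY m : (P (BY m) <= (N.+1%:R^-1)%:E)%E.
  have mm : m%:R / N.+1%:R <= m.+1%:R / N.+1%:R :> R.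
    by rewrite ler_pM2r ?invr_gt0// ler_nat.
  have := exponential_interval_le mm; rewrite -mulrBl -natrB// subSnn mul1r.
  by rewrite -(@gap_exponential _ _ _ X i k)//; exact: measurable_itv.
have SB : S `<=` \bigcup_m (BY m `&` BZ m).
  move=> w; rewrite /S /= arrivalS => wS.
  have Yw : Z w = gap X i k w by rewrite /Z -wS addrAC subrr add0r.
  suff [m Bm] : exists m, B m (gap X i k w).
    by exists m => //; split; rewrite ?/BZ /= ?Yw.
  have g0 : 0 <= gap X i k w * N.+1%:R by rewrite mulr_ge0 ?(ltW (gap_gt0 _ _ _)).
  exists (Num.truncn (gap X i k w * N.+1%:R)).
  rewrite /B /= in_itv/= ler_pdivrMr// ltr_pdivlMr//.
  by have := truncn_itv g0.
have mYZ m : measurable (BY m `&` BZ m) by have [? ? _] := YZ m; exact: measurableI.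
apply: (le_trans (measure_sigma_subadditive P mYZ mS SB)).
apply: (@le_trans _ _ (\sum_(0 <= m <oo) (N.+1%:R^-1)%:E * P (BZ m)))%E.
  apply: lee_nneseries => [m _ _|m _]; first exact: measure_ge0.
  have [_ _ e] := YZ m; apply: (@le_trans _ _ (P (BY m) * P (BZ m))%E); first by rewrite -e.
  exact: lee_wpmul2r.
rewrite nneseriesZl//.
rewrite -[leRHS]mule1 lee_wpmul2l ?lee_fin ?invr_ge0//.
have BZtriv : trivIset setT BZ.
  apply: ltn_trivIset => a b ba; rewrite -subset0 => w [].
  rewrite /BZ /B /= !in_itv/= => /andP[_ Zb] /andP[aZ _].
  by move: (le_lt_trans aZ Zb); rewrite ltr_pM2r ?invr_gt0// ltr_nat ltnS leqNgt ba.
have mBZ m : measurable (BZ m) by have [] := YZ m.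
rewrite (_ : (\sum_(0 <= m <oo) P (BZ m))%E = P (\bigcup_m BZ m)).
  by apply: probability_le1; exact: bigcupT_measurable.
by rewrite measure_bigcup//; apply: eq_eseriesl => m; rewrite in_setT.
Qed.

End SimultaneousRings.

(** * Exit times *)

Section ExitTime.
Variables (R : realType) (n : nat) (p : R) (X : dynamics n p).
Local Notation P := (prob X).

Let gap_pos i w k : 0 < gap X i k w := gap_gt0 i k w.
Let unbounded i w := @arrival_unbounded R n p X i w.

Lemma measurable_state t z : 0 <= t -> measurable [set w : sample X | state t w = z].
Proof.
move=> t0; have -> : [set w : sample X | state t w = z] =
    \bigcap_i (pair_event t i (true, z i) `|` pair_event t i (false, z i)).
  apply/seteqP; split=> [w /= <- i _|w h].
    by rewrite !ffunE /pair_event /=; case: (spin X i 0 w); [left|right].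
  by apply/ffunP => i; rewrite ffunE; have [[]|[]] := h i Logic.I.
apply: fin_bigcap_measurable => [|i _]; first exact: finite_finset.
by apply: measurableU; apply: generated_measurable; exact: pair_event_generated.
Qed.

Lemma measurable_state_rel t (D : rel (cube n)) : 0 <= t ->
  measurable [set w : sample X | D (state t w) (state 0 w)].
Proof.
move=> t0; apply: (measurable_finite_valued (h := fun w : sample X => (state t w, state 0 w))
  _ [set z | D z.1 z.2]) => -[x y].
rewrite (_ : mkset _ = [set w : sample X | state t w = x] `&` [set w | state 0 w = y]).
  by apply: measurableI; exact: measurable_state.
by apply/seteqP; split=> w /= [-> ->].
Qed.

Lemma state_right_constant t w : 0 <= t ->
  exists2 v, t < v & forall u, t <= u < v -> state u w = state (X := X) t w.
Proof.
move=> t0; pose c i := count i t w.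
have cE i : arrival (gap X i ^~ w) (c i) <= t < arrival (gap X i ^~ w) (c i).+1.
  exact/(ring_countP (gap_pos i w) (unbounded i w)).
exists (\big[Num.min/(t + 1)]_i arrival (gap X i ^~ w) (c i).+1).
  by apply: lt_bigmin => [|i _]; [rewrite ltrDl | have /andP[] := cE i].
move=> u /andP[tu uv]; apply/ffunP => i; rewrite !ffunE; congr (spin X i _ w).
apply/(ring_countP (gap_pos i w) (unbounded i w)); first exact: le_trans tu.
have /andP[ct _] := cE i; rewrite (le_trans ct tu) (lt_le_trans uv)//.
exact: bigmin_le.
Qed.

Lemma lt_exit_timeP (f : cube n -> bool) (t : R) w : 0 <= t ->
  (t%:E < exit_time f w)%E <->
  exists N : nat, forall q : rat, 0 <= (ratr q : R) < t + N.+1%:R^-1 ->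
    f (state (X := X) (ratr q) w) = f (state 0 w).
Proof.
move=> t0; split=> [tE|[N fq]].
  have [N tN] : exists N : nat, ((t + N.+1%:R^-1)%:E <= exit_time f w)%E.
    move: tE; case: (exit_time f w) => [r| |]//; last by exists 0%N; rewrite leey.
    by rewrite lte_fin => /ltr_add_invr[N /ltW tN]; exists N; rewrite lee_fin.
  exists N => q /andP[q0 qt]; apply: contrapT => fq.
  have : (exit_time f w <= (ratr q : R)%:E)%E.
    by apply: ereal_inf_lbound; exists (ratr q).
  by move/(le_trans tN); rewrite lee_fin leNgt qt.
apply: (@lt_le_trans _ _ (t + N.+1%:R^-1)%:E); first by rewrite lte_fin ltrDl invr_gt0.
apply: le_ereal_inf_tmp => _ [u [u0 fu] <-]; rewrite lee_fin leNgt; apply/negP => ut.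
have [v uv vE] := state_right_constant w u0.
have [|q] := @rat_in_itvoo R u (Num.min v (t + N.+1%:R^-1)); first by rewrite lt_min uv.
rewrite in_itv/= lt_min => /and3P[uq qv qt].
apply: fu; rewrite -(vE (ratr q)) ?(ltW uq)// fq//.
by rewrite qt (le_trans u0)// ltW.
Qed.

Lemma measurable_lt_exit_time (f : cube n -> bool) (t : R) : 0 <= t ->
  measurable [set w : sample X | (t%:E < exit_time f w)%E].
Proof.
move=> t0; pose A (N : nat) (q : rat) : set (sample X) :=
  [set w | 0 <= (ratr q : R) < t + N.+1%:R^-1 -> f (state (ratr q) w) = f (state 0 w)].
have -> : [set w : sample X | (t%:E < exit_time f w)%E] = \bigcup_N \bigcap_q A N q.
  apply/seteqP; split=> [w /= /(lt_exit_timeP _ _ t0)[N h]|w [N _ h]].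
    by exists N => // q _; exact: h.
  by apply/(lt_exit_timeP _ _ t0); exists N => q; exact: h.
apply: bigcupT_measurable => N; rewrite -[X in measurable X]setCK setC_bigcap.
apply: measurableC; apply: bigcupT_measurable_rat => q; apply: measurableC.
have [qt|qt] := boolP (0 <= (ratr q : R) < t + N.+1%:R^-1); last first.
  by rewrite (_ : A N q = setT)//; apply/seteqP; split=> // w _; rewrite /A /= (negbTE qt).
rewrite (_ : A N q = [set w | f (state (ratr q) w) == f (state 0 w)]).
  by apply: (measurable_state_rel (fun x y => f x == f y)); have /andP[] := qt.
by apply/seteqP; split=> w; rewrite /A /= qt; [move=> /(_ isT)/eqP | move=> /eqP].
Qed.

Definition overwrite (m r r' : nat) (f : cube n -> bool) (x : cube n) :=
  if (ones x %% m == r)%N then true else if (ones x %% m == r')%N then false else f x.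

Lemma residue_between (a b m r : nat) : (r < m)%N -> (a + m <= b)%N ->
  exists2 v, (a <= v <= b)%N & (v %% m = r)%N.
Proof.
move=> rm amb; have m0 : (0 < m)%N by lia.
exists (a + (r + (m - a %% m)) %% m)%N.
  by have := ltn_pmod (r + (m - a %% m)) m0; lia.
have am := ltn_pmod a m0.
rewrite modnDmr; have -> : (a + (r + (m - a %% m)) = (a %/ m).+1 * m + r)%N.
  rewrite mulSn; move: am (divn_eq a m).
  by move: (a %% m)%N (a %/ m * m)%N => x y; lia.
by rewrite modnMDl modn_small.
Qed.

Lemma exit_time_overwrite (m r r' : nat) f (t : R) w :
  (r < m)%N -> (r' < m)%N -> r != r' -> 0 <= t ->
  (forall i j k l, i != j ->
    arrival (gap X i ^~ w) k.+1 <> arrival (gap X j ^~ w) l.+1) ->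
  (t%:E < exit_time (X := X) (overwrite m r r' f) w)%E ->
  `|(ones (state t w))%:R - (ones (state 0 w))%:R| <= m%:R :> R.
Proof.
move=> rm r'm rr' t0 nosim tE; rewrite leNgt; apply/negP => mS.
set g := overwrite _ _ _ _ in tE.
have hit v : (ones (state 0 w) <= v <= ones (state t w))%N
    || (ones (state t w) <= v <= ones (state 0 w))%N ->
    exists2 u, 0 <= u <= t & ones (state u w) = v.
  have onesE u : ones (state u w) = (\sum_i spin X i (ring_count (gap X i ^~ w) u) w)%N.
    by apply: eq_bigr => i _; rewrite ffunE.
  rewrite !onesE => hv; have [u ut uv] := @path_intermediate_value R n (fun i k => gap X i k w)
     (fun i k => gap_gt0 i k w) (fun i => unbounded i w) nosim
     (fun i k => spin X i k w) t v t0 hv.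
  by exists u; rewrite // onesE.
have hit_residue s : (s < m)%N -> exists2 u, 0 <= u <= t & (ones (state u w) %% m = s)%N.
  move=> sm; move: mS; rewrite ltr_normr opprB !ltrBrDl -!natrD !ltr_nat.
  case/orP => /ltnW /(residue_between sm)[v vS vs].
    by have [|u ut uv] := hit v; [rewrite vS | exists u => //; rewrite uv].
  by have [|u ut uv] := hit v; [rewrite vS orbT | exists u => //; rewrite uv].
have g_const u : 0 <= u <= t -> g (state u w) = g (state 0 w).
  move=> /andP[u0 ut]; apply: contrapT => gu.
  have : (exit_time g w <= u%:E)%E by apply: ereal_inf_lbound; exists u.
  by move/(lt_le_trans tE); rewrite lte_fin ltNge ut.
have [u ut ur] := hit_residue r rm; have [u' ut' ur'] := hit_residue r' r'm.
have := g_const u ut; rewrite -(g_const u' ut') /g /overwrite ur ur' eqxx.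
by rewrite eq_sym (negbTE rr') eqxx.
Qed.

End ExitTime.

Lemma exists_unlikely_value (R : realType) (d : measure_display) (T : measurableType d)
    (P : probability T R) (W : finType) (h : T -> W) (D : pred W) :
  (forall x, measurable [set w | h w = x]) -> (0 < #|D|)%N ->
  exists2 x, D x & (P [set w | h w = x] <= (#|D|%:R^-1)%:E)%E.
Proof.
move=> mh D0; apply: contrapT => noD.
have D_gt0 : (0 : R) < #|D|%:R by rewrite ltr0n.
pose q x := fine (P [set w | h w = x]).
have qE x : P [set w | h w = x] = (q x)%:E by rewrite fineK// fin_num_measure.
have : \sum_(x | D x) q x <= 1.
  rewrite -lee_fin -sumEFin; under eq_bigr do rewrite -qE.
  rewrite -(probability_finite_valued P mh).
  exact/probability_le1/(measurable_finite_valued mh [set x | D x]).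
have : \sum_(x | D x) #|D|%:R^-1 < \sum_(x | D x) q x.
  apply: ltr_sum => [|x Dx].
    have /card_gt0P[x Dx] := D0; by apply/hasP; exists x; rewrite ?mem_index_enum.
  rewrite ltNge; apply/negP => qD; apply: noD; exists x => //.
  by rewrite qE lee_fin.
rewrite sumr_const -[_ *+ _]mulr_natr mulVf ?gt_eqF//.
by move=> /lt_le_trans h1 /h1; rewrite ltxx.
Qed.

Section Perturbation.
Variables (R : realType) (n : nat) (p : R) (X : dynamics n p).
Local Notation P := (prob X).

Lemma volatile_perturbation (K : nat) (f : cube n -> bool) :
  exists g : cube n -> bool,
    (P [set w | f (state 0 w) <> g (state 0 w)] <= (2 / K.+1%:R)%:E)%E /\
    forall t : R, 0 <= t -> (P [set w | t%:E < exit_time g w] <=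
      P [set w | (`|(ones (state t w))%:R - (ones (state 0 w))%:R| <= K.+2%:R :> R)%R])%E.
Proof.
pose h (w : sample X) : 'I_K.+2 := inord (ones (state 0 w) %% K.+2).
have mh x : measurable [set w | h w = x].
  rewrite (_ : [set _ | _] = [set w : sample X | inord (ones (state 0 w) %% K.+2) == x]).
    by apply: (measurable_state_rel X (fun _ y => inord (ones y %% K.+2) == x) (lexx 0)).
  by apply/seteqP; split=> w /eqP.
have [|r _ Pr] := exists_unlikely_value P (D := predT) mh; first by rewrite card_ord.
have [|r' rr' Pr'] := exists_unlikely_value P (D := predC1 r) mh.
  by rewrite cardC1 card_ord.
exists (overwrite K.+2 r r' f); split.
  apply: (@le_trans _ _ (P ([set w | h w = r] `|` [set w | h w = r']))).
    apply: le_measure; rewrite ?inE.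
    - rewrite (_ : mkset _ = [set w | f (state 0 w) != overwrite K.+2 r r' f (state 0 w)]).
        exact: (measurable_state_rel X
          (fun _ y => f y != overwrite K.+2 r r' f y) (lexx 0)).
      by apply/seteqP; split=> w /= /eqP.
    - exact: measurableU.
    move=> w /=; rewrite /overwrite; case: eqP => [wr _|_].
      by left; apply/val_inj; rewrite /h /= inordK ?ltn_pmod.
    case: eqP => [wr' _|//].
    by right; apply/val_inj; rewrite /h /= inordK ?ltn_pmod.
  apply: le_trans (measureU2 _ _ _) _ => //.
  rewrite mulr_natl mulr2n EFinD; apply: leeD.
    by apply: le_trans Pr _; rewrite lee_fin card_ord lef_pV2 ?posrE ?ltr0n// ler_nat.
  by apply: le_trans Pr' _; rewrite cardC1 card_ord.
move=> t t0.
pose collision (m : nat) : set (sample X) :=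
  if (choice.unpickle m : option ('I_n * 'I_n * (nat * nat))) is Some (i, j, (k, l)) then
    if i == j then set0
    else [set w | arrival (gap X i ^~ w) k.+1 = arrival (gap X j ^~ w) l.+1]
  else set0.
have collision_m m : measurable (collision m).
  rewrite /collision; case: choice.unpickle => // -[[i j] [k l]]; case: eqP => // _.
  exact: measurable_simultaneous.
have collision0 m : P (collision m) = 0%E.
  rewrite /collision; case: choice.unpickle => [[[i j] [k l]]|]; last exact: measure0.
  by case: eqP => [_|/eqP ij]; [exact: measure0 | exact: simultaneous_negligible].
have collisions_m : measurable (\bigcup_m collision m) by exact: bigcupT_measurable.
have collisions0 : P (\bigcup_m collision m) = 0%E.
  by apply: measure_negligible => //; apply: negligible_bigcup => m;
    apply/negligibleP; [exact: collision_m | exact: collision0].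
pose near_start : set (sample X) :=
  [set w | (`|(ones (state t w))%:R - (ones (state 0 w))%:R| <= K.+2%:R :> R)%R].
have near_m : measurable near_start.
  exact: (measurable_state_rel X (fun x y => `|(ones x)%:R - (ones y)%:R| <= K.+2%:R :> R) t0).
apply: (@le_trans _ _ (P (\bigcup_m collision m `|` near_start))).
  apply: le_measure; rewrite ?inE; [exact: measurable_lt_exit_time | exact: measurableU|].
  move=> w /= tE; have [cw|ncw] := pselect ((\bigcup_m collision m) w); first by left.
  right; apply: (exit_time_overwrite (ltn_ord r) (ltn_ord r') _ t0 _ tE).
    by rewrite eq_sym.
  move=> i j k l ij e; apply: ncw; exists (choice.pickle (i, j, (k, l))) => //.
  by rewrite /collision choice.pickleK (negbTE ij).
apply: le_trans (measureU2 _ _ _) _ => //.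
by rewrite [X in (X + _)%E]collisions0 add0e.
Qed.

End Perturbation.

Lemma diagonal_index (Q : nat -> nat -> Prop) :
  (forall K, \forall n \near \oo, Q K n) ->
  exists k : nat -> nat, (forall K, \forall n \near \oo, (K <= k n)%N) /\
    \forall n \near \oo, Q (k n) n.
Proof.
move=> Qnear; have /choice[N QN] : forall K, exists N, forall n, (N <= n)%N -> Q K n.
  by move=> K; have [N _ NQ] := Qnear K; exists N => n; exact: NQ.
exists (fun n => \max_(K < n | (N K <= n)%N) K); split=> [K|].
  exists (maxn (N K) K.+1) => // n /=; rewrite geq_max => /andP[NKn Kn].
  exact: (leq_bigmax_cond (Ordinal Kn)).
exists (maxn (N 0%N) 1) => // n /=; rewrite geq_max => /andP[N0n n0].
have [|K] := @eq_bigmax_cond _ [pred K : 'I_n | (N K <= n)%N] (fun K => K : nat).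
  by apply/card_gt0P; exists (Ordinal n0); rewrite inE.
by rewrite inE => NK ->; exact: QN.
Qed.

Lemma squeeze_cvge0 (R : realType) (u : nat -> \bar R) :
  (forall n, (0 <= u n)%E) ->
  (forall e : R, 0 < e -> \forall n \near \oo, (u n <= e%:E)%E) ->
  u @ \oo --> 0%E.
Proof.
move=> u0 ue; apply/fine_cvgP; split.
  near=> n; rewrite ge0_fin_numE//; apply: (@le_lt_trans _ _ 1%:E); last exact: ltry.
  by near: n; exact: ue.
apply/cvgrPdist_le => e e0; near=> n.
rewrite sub0r normrN ger0_norm ?fine_ge0//=.
have une : (u n <= e%:E)%E by near: n; exact: ue.
by rewrite -lee_fin fineK// ge0_fin_numE// (le_lt_trans une)// ltry.
Unshelve. all: by end_near. Qed.

Theorem theorem1p4 (R : realType) (p : nat -> R)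
    (p01 : forall n, (0 < n)%N -> 0 <= p n <= 1)
    (np_infty : (fun n : nat => n%:R * p n * (1 - p n)) @ \oo --> +oo)
    (X : forall n, dynamics n (p n)) (f : boolfun_seq) :
  exists g : boolfun_seq, volatile X g /\ o1_close X f g.
Proof.
pose slow K n := (prob (X n) [set w | (`|(ones (state K.+1%:R^-1 w))%:R
  - (ones (state 0 w))%:R| <= K.+2%:R :> R)%R] <= (K.+1%:R^-1)%:E)%E.
have slow_near K : \forall n \near \oo, slow K n.
  have K0 : (0 : R) < K.+1%:R^-1 by rewrite invr_gt0.
  have [C HC] := displacement_unlikely K.+2 K0 K0.
  near=> n; apply: HC; first by apply: p01; near: n; exists 1%N.
  by near: n; have /cvgryPge := np_infty; exact.
have [k [k_infty k_slow]] := diagonal_index slow_near.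
pose g n := sval (cid (volatile_perturbation (X n) (k n) (f n))).
have gP n := svalP (cid (volatile_perturbation (X n) (k n) (f n))).
have small (e : R) : 0 < e -> \forall n \near \oo, (k n).+1%:R^-1 <= e.
  move=> e0; near=> n; rewrite invf_ple ?posrE ?ltr0n//.
  have /ltW := truncnS_gt e^-1; move/le_trans; apply; rewrite ler_nat ltnS.
  by near: n; exact: k_infty.
exists g; split.
  move=> delta delta0; apply: squeeze_cvge0 => [n|e e0]; first exact: measure_ge0.
  near=> n.
  have kd : (k n).+1%:R^-1 <= delta by near: n; exact: small.
  have ke : (k n).+1%:R^-1 <= e by near: n; exact: small.
  apply: (@le_trans _ _ (prob (X n) [set w | ((k n).+1%:R^-1)%:E < exit_time (g n) w])%E).
    apply: le_measure; rewrite ?inE.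
    - by apply: measurable_lt_exit_time; exact: ltW.
    - by apply: measurable_lt_exit_time; rewrite invr_ge0.
    by move=> w /=; apply: le_lt_trans; rewrite lee_fin.
  have [_ gn] := gP n; apply: le_trans (gn _ _) _; first by rewrite invr_ge0.
  apply: (@le_trans _ _ ((k n).+1%:R^-1)%:E); last by rewrite lee_fin.
  by near: n.
apply: squeeze_cvge0 => [n|e e0]; first exact: measure_ge0.
near=> n; have [gn _] := gP n; apply: le_trans gn _; rewrite lee_fin.
rewrite mulrC -ler_pdivlMr//; near: n; apply: small; exact: divr_gt0.
Unshelve. all: by end_near. Qed.
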